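(* Let $R=\mathbb{C}[t_{(1)},t_{(-1)},t_{(2)},t_{(-2)},t_{(3)},t_{(-3)},t_{(4)},t_{(-4)}]$ be a polynomial ring in eight variables, let $\Pi:R[t_{(5)},t_{(-5)}]\to\mathbb{C}[G\times G]^G$ be the surjective trace homomorphism defined in the context, where $G=\mathrm{SL}(3,\mathbb{C})$, and let $I$ be the kernel of the surjective composite $$R[t_{(5)}]\hookrightarrow R[t_{(5)},t_{(-5)}]\twoheadrightarrow R[t_{(5)},t_{(-5)}]/\ker(\Pi).$$ Let $P\in R$ be $$P=t_{(1)}t_{(-1)}t_{(2)}t_{(-2)}-t_{(1)}t_{(2)}t_{(-3)}-t_{(-1)}t_{(-2)}t_{(3)}-t_{(1)}t_{(-2)}t_{(-4)}-t_{(-1)}t_{(2)}t_{(4)}+t_{(1)}t_{(-1)}+t_{(2)}t_{(-2)}+t_{(3)}t_{(-3)}+t_{(4)}t_{(-4)}-3.$$ Suppose $Q\in R$ satisfies $Q-t_{(5)}t_{(-5)}\in\ker(\Pi)$. Then $I$ is the principal ideal of $R[t_{(5)}]$ generated by $$t_{(5)}^2-Pt_{(5)}+Q.$$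
   Context: $G=\mathrm{SL}(3,\mathbb{C})$ acts on $G\times G$ by simultaneous conjugation; $\mathbf{x}_1,\mathbf{x}_2$ are the generic unimodular $3\times3$ matrices of the two factors. $\Pi$ is the $\mathbb{C}$-algebra homomorphism with $t_{(1)}\mapsto\mathrm{tr}(\mathbf{x}_1)$, $t_{(-1)}\mapsto\mathrm{tr}(\mathbf{x}_1^{-1})$, $t_{(2)}\mapsto\mathrm{tr}(\mathbf{x}_2)$, $t_{(-2)}\mapsto\mathrm{tr}(\mathbf{x}_2^{-1})$, $t_{(3)}\mapsto\mathrm{tr}(\mathbf{x}_1\mathbf{x}_2)$, $t_{(-3)}\mapsto\mathrm{tr}(\mathbf{x}_1^{-1}\mathbf{x}_2^{-1})$, $t_{(4)}\mapsto\mathrm{tr}(\mathbf{x}_1\mathbf{x}_2^{-1})$, $t_{(-4)}\mapsto\mathrm{tr}(\mathbf{x}_1^{-1}\mathbf{x}_2)$, $t_{(5)}\mapsto\mathrm{tr}(\mathbf{x}_1\mathbf{x}_2\mathbf{x}_1^{-1}\mathbf{x}_2^{-1})$, $t_{(-5)}\mapsto\mathrm{tr}(\mathbf{x}_2\mathbf{x}_1\mathbf{x}_2^{-1}\mathbf{x}_1^{-1})$. $\Pi$ is surjective and $P-(t_{(5)}+t_{(-5)})\in\ker(\Pi)$. *)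

(* Defs.v *)
From HB Require Import structures.
From mathcomp Require Import all_boot all_order all_algebra.
From mathcomp Require Import ring_quotient.
From mathcomp Require Import boolp classical_sets functions reals.
From mathcomp Require Import complex mpoly.

Set Implicit Arguments.
Unset Strict Implicit.
Unset Printing Implicit Defensive.

Import GRing.Theory.
Local Open Scope ring_scope.

(* The field of complex numbers is R[i], for R : realType an arbitrary model of
   the real numbers. *)

Record SL3 (R : realType) := MkSL3 {
  SL3_mx :> 'M[R[i]]_3;
  SL3_det : \det SL3_mx == 1 }.

HB.instance Definition _ (R : realType) := [isSub for @SL3_mx R].
HB.instance Definition _ (R : realType) := [Choice of SL3 R by <:].

Section SL3_group.
Variable R : realType.
Implicit Types g h : SL3 R.

Lemma detSL3 g : \det g = 1. Proof. exact/eqP/SL3_det. Qed.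

Lemma unitSL3 g : (g : 'M_3) \in unitmx.
Proof. by rewrite unitmxE detSL3 unitr1. Qed.

Fact SL3_one_det : \det (1%:M : 'M[R[i]]_3) == 1.
Proof. by rewrite det1. Qed.
Definition SL3_one : SL3 R := MkSL3 SL3_one_det.

Fact SL3_inv_det g : \det (invmx g) == 1.
Proof. by rewrite det_inv detSL3 invr1. Qed.
Definition SL3_inv g : SL3 R := MkSL3 (SL3_inv_det g).

Fact SL3_mul_det g h : \det (g *m h) == 1.
Proof. by rewrite det_mulmx !detSL3 mulr1. Qed.
Definition SL3_mul g h : SL3 R := MkSL3 (SL3_mul_det g h).

Fact SL3_mulA : associative SL3_mul.
Proof. by move=> x y z; apply: val_inj; rewrite /= mulmxA. Qed.
Fact SL3_mul1 : left_id SL3_one SL3_mul.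
Proof. by move=> x; apply: val_inj; rewrite /= mul1mx. Qed.
Fact SL3_mulx1 : right_id SL3_one SL3_mul.
Proof. by move=> x; apply: val_inj; rewrite /= mulmx1. Qed.
Fact SL3_mulV : left_inverse SL3_one SL3_inv SL3_mul.
Proof. by move=> x; apply: val_inj; rewrite /= mulVmx // unitSL3. Qed.
Fact SL3_mulxV : right_inverse SL3_one SL3_inv SL3_mul.
Proof. by move=> x; apply: val_inj; rewrite /= mulmxV // unitSL3. Qed.

HB.instance Definition _ := isGroup.Build (SL3 R)
  SL3_mulA SL3_mul1 SL3_mulx1 SL3_mulV SL3_mulxV.
HB.instance Definition _ := isPointed.Build (SL3 R) SL3_one.

End SL3_group.

Section InvariantRing.
Variable R : realType.
Local Notation C := R[i].
Local Notation G := (SL3 R).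

(* The coordinate ring C[G x G] of the affine variety G x G consists of the
   restrictions to G x G of the polynomials in the 9 + 9 matrix entries. *)
Definition coords (x : G * G) : 'rV[C]_(3 * 3 + 3 * 3) :=
  row_mx (mxvec x.1) (mxvec x.2).

Definition regular (f : G * G -> C) : Prop :=
  exists p : {mpoly C[3 * 3 + 3 * 3]}, forall x, f x = p.@[coords x 0].

(* x ^ g is the conjugate g^-1 * x * g. *)
Definition conj_invariant (f : G * G -> C) : Prop :=
  forall (g : G) (x : G * G), f ((x.1 ^ g)%g, (x.2 ^ g)%g) = f x.

Definition invariant_pred : {pred (G * G -> C)} :=
  fun f => `[< regular f /\ conj_invariant f >].

Lemma regular_cst c : regular (fun=> c).
Proof. by exists c%:MP => x; rewrite mevalC. Qed.

Lemma regularB f h : regular f -> regular h -> regular (fun x => f x - h x).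
Proof.
by move=> [p pf] [q qh]; exists (p - q) => x; rewrite mevalB pf qh.
Qed.

Lemma regularM f h : regular f -> regular h -> regular (fun x => f x * h x).
Proof.
by move=> [p pf] [q qh]; exists (p * q) => x; rewrite mevalM pf qh.
Qed.

Fact invariant_subring : subring_closed invariant_pred.
Proof.
split.
- by apply/asboolP; split=> //; exact: regular_cst.
- move=> f h /asboolP[rf cf] /asboolP[rh ch]; apply/asboolP; split.
    exact: (regularB rf rh).
  by move=> g x; rewrite [LHS](congr2 +%R (cf g x) (congr1 -%R (ch g x))).
- move=> f h /asboolP[rf cf] /asboolP[rh ch]; apply/asboolP; split.
    exact: (regularM rf rh).
  by move=> g x; rewrite [LHS](congr2 *%R (cf g x) (ch g x)).
Qed.
HB.instance Definition _ :=
  GRing.isSubringClosed.Build (G * G -> C) invariant_pred invariant_subring.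

(* C[G x G]^G, as a subring of the ring of all functions G x G -> C. *)
Record invariant_ring := MkInvariant {
  inv_fun :> G * G -> C;
  inv_funP : inv_fun \in invariant_pred }.

HB.instance Definition _ := [isSub for inv_fun].
HB.instance Definition _ := [Choice of invariant_ring by <:].
HB.instance Definition _ :=
  [SubChoice_isSubComNzRing of invariant_ring by <:].

Fact inv_cst_in (c : C) : (fun=> c : C) \in invariant_pred.
Proof. by apply/asboolP; split=> //; exact: regular_cst. Qed.
Definition inv_cst (c : C) : invariant_ring := MkInvariant (inv_cst_in c).

Fact inv_cst_is_zmod : zmod_morphism inv_cst.
Proof. by move=> a b; apply: val_inj. Qed.
Fact inv_cst_is_monoid : monoid_morphism inv_cst.
Proof. by split=> [|a b]; apply: val_inj. Qed.
HB.instance Definition _ :=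
  GRing.isZmodMorphism.Build C invariant_ring inv_cst inv_cst_is_zmod.
HB.instance Definition _ :=
  GRing.isMonoidMorphism.Build C invariant_ring inv_cst inv_cst_is_monoid.

(* Words in the two generic unimodular matrices and their inverses. *)
Inductive word := X1 | X2 | Inv of word | Mul of word & word.

Fixpoint eval_word (w : word) (x : G * G) : G :=
  match w with
  | X1 => x.1
  | X2 => x.2
  | Inv u => (eval_word u x)^-1%g
  | Mul u v => (eval_word u x * eval_word v x)%g
  end.

Lemma regular_sum (I : finType) (F : I -> G * G -> C) :
  (forall i, regular (F i)) -> regular (fun x => \sum_i F i x).
Proof.
move=> rF; have [p pF] := choice rF.
by exists (\sum_i p i) => x; rewrite raddf_sum; apply: eq_bigr => i _; exact: pF.
Qed.

Lemma regular_prod (I : finType) (F : I -> G * G -> C) :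
  (forall i, regular (F i)) -> regular (fun x => \prod_i F i x).
Proof.
move=> rF; have [p pF] := choice rF.
by exists (\prod_i p i) => x; rewrite rmorph_prod; apply: eq_bigr => i _; exact: pF.
Qed.

Lemma regular_det n (M : G * G -> 'M[C]_n) :
  (forall i j, regular (fun x => M x i j)) -> regular (fun x => \det (M x)).
Proof.
move=> rM; apply: regular_sum => s.
by apply: regularM; [exact: regular_cst | exact: regular_prod].
Qed.

Lemma regular_ext (f h : G * G -> C) : f =1 h -> regular f -> regular h.
Proof. by move=> fh [p pf]; exists p => x; rewrite -fh. Qed.

Lemma regular_word w i j : regular (fun x => eval_word w x i j).
Proof.
elim: w i j => [||u IHu|u IHu v IHv] i j /=.
- exists 'X_(lshift _ (mxvec_index i j)) => x.
  by rewrite mevalXU /coords row_mxEl mxvecE.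
- exists 'X_(rshift _ (mxvec_index i j)) => x.
  by rewrite mevalXU /coords row_mxEr mxvecE.
- apply: (@regular_ext (fun x => (\adj (eval_word u x)) i j)) => [x|].
    by rewrite /invmx unitSL3 detSL3 invr1 scale1r.
  apply: (@regular_ext (fun x => cofactor (eval_word u x) j i)) => [x|].
    by rewrite mxE.
  apply: regularM; first exact: regular_cst.
  apply: regular_det => k l; apply: regular_ext (IHu (lift j k) (lift i l)).
  by move=> x; rewrite !mxE.
- apply: (@regular_ext (fun x => \sum_k eval_word u x i k * eval_word v x k j)).
    by move=> x; rewrite mxE.
  by apply: regular_sum => k; exact: regularM.
Qed.

Lemma eval_word_conj w (g : G) (x : G * G) :
  eval_word w ((x.1 ^ g)%g, (x.2 ^ g)%g) = (eval_word w x ^ g)%g.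
Proof.
elim: w => [||u IHu|u IHu v IHv] //=.
- by rewrite IHu conjVg.
- by rewrite IHu IHv conjMg.
Qed.

Fact trace_word_in w : (fun x => \tr (eval_word w x)) \in invariant_pred.
Proof.
apply/asboolP; split; first by apply: regular_sum => i; exact: regular_word.
move=> g x; rewrite eval_word_conj /conjg /=.
by rewrite mxtrace_mulC -mulmxA mulmxV ?mulmx1 ?unitSL3.
Qed.

Definition tr (w : word) : invariant_ring := MkInvariant (trace_word_in w).

End InvariantRing.

Section TraceHomomorphism.
Variable R : realType.

(* The eight variables of the ring Rt are ordered as
   t_(1), t_(-1), t_(2), t_(-2), t_(3), t_(-3), t_(4), t_(-4). *)
Local Notation Rt := {mpoly R[i][8]}.

Definition t1  : Rt := 'X_(inord 0).
Definition tm1 : Rt := 'X_(inord 1).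
Definition t2  : Rt := 'X_(inord 2).
Definition tm2 : Rt := 'X_(inord 3).
Definition t3  : Rt := 'X_(inord 4).
Definition tm3 : Rt := 'X_(inord 5).
Definition t4  : Rt := 'X_(inord 6).
Definition tm4 : Rt := 'X_(inord 7).

(* Rt[t_(5), t_(-5)] is encoded as Rt[t_(5)][t_(-5)], so that the inclusion of
   Rt[t_(5)] into it is polyC. *)
Definition t5  : {poly {poly Rt}} := 'X%:P.
Definition tm5 : {poly {poly Rt}} := 'X.

Definition Pi_word (i : 'I_8) : word :=
  tnth [tuple X1; Inv X1;
              X2; Inv X2;
              Mul X1 X2; Mul (Inv X1) (Inv X2);
              Mul X1 (Inv X2); Mul (Inv X1) X2] i.

Definition Pi_Rt : {rmorphism Rt -> invariant_ring R} :=
  mmap (@inv_cst R) (fun i => tr R (Pi_word i)).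

Definition Pi_Rt5 : {rmorphism {poly Rt} -> invariant_ring R} :=
  horner_eval (tr R (Mul (Mul X1 X2) (Mul (Inv X1) (Inv X2))))
    \o map_poly Pi_Rt.

Definition Pi : {rmorphism {poly {poly Rt}} -> invariant_ring R} :=
  horner_eval (tr R (Mul (Mul X2 X1) (Mul (Inv X2) (Inv X1))))
    \o map_poly Pi_Rt5.

Definition ker_Pi : {pred {poly {poly Rt}}} := fun F => Pi F == 0.

Fact ker_Pi_idealr : idealr_closed ker_Pi.
Proof.
split.
- by rewrite unfold_in; apply/eqP; exact: rmorph0.
- by rewrite unfold_in; apply/negP => /eqP; rewrite rmorph1; move/eqP; rewrite oner_eq0.
- move=> F H K /eqP H0 /eqP K0; rewrite unfold_in; apply/eqP.
  by rewrite rmorphD rmorphM H0 K0 mulr0 addr0.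
Qed.
HB.instance Definition _ :=
  isIdealr.Build {poly {poly Rt}} ker_Pi ker_Pi_idealr.

Definition quot_Pi : {rmorphism {poly Rt} -> {ideal_quot ker_Pi}} :=
  \pi_{ideal_quot ker_Pi}%qT \o polyC.

Definition ideal_I : set {poly Rt} := [set F | quot_Pi F = 0]%classic.

Definition trace_P : Rt :=
  t1 * tm1 * t2 * tm2 - t1 * t2 * tm3 - tm1 * tm2 * t3 - t1 * tm2 * tm4
  - tm1 * t2 * t4 + t1 * tm1 + t2 * tm2 + t3 * tm3 + t4 * tm4 - 3%:R.

End TraceHomomorphism.

Arguments ker_Pi R _ : clear implicits.
Arguments ideal_I R _ : clear implicits.

Definition principal_ideal (A : comNzRingType) (a : A) : set A :=
  [set b * a | b in [set: A]]%classic.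

(* Main.v *)
From HB Require Import structures.
Require Import Defs.
From mathcomp Require Import all_boot all_algebra classical_sets reals complex mpoly.
From mathcomp Require Import polydiv ring_quotient ring.
Import GRing.Theory Num.Theory Pdiv.Ring Pdiv.RingMonic.
Local Open Scope ring_scope.
Local Open Scope complex_scope.

(** A polynomial identity valid for all pairs of 3x3 matrices, with adjugates in
    place of inverses, gives t_(5) + t_(-5) = P modulo ker Pi, so the monic
    quadratic D := t_(5)^2 - P t_(5) + Q lies in I. Division by D leaves a
    remainder a t_(5) + b with a, b in R, and it remains to see that such an
    element of I vanishes. Simultaneous transposition preserves the eight traces
    and exchanges tr [x1, x2] and tr [x2, x1], whence a (t_(5) - t_(-5)) and then
    a (P^2 - 4 Q) map to 0 under Pi. Since R is a domain and P^2 - 4 Q, which maps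
    to (tr [x1, x2] - tr [x2, x1])^2, is nonzero, a = 0 and b = 0 follow once Pi
    is known to be injective on R.

    For the latter, eight prescribed values of the traces are attained as soon as
    the discriminant of the characteristic polynomial of x1 is nonzero: take x1
    diagonal; the traces involving x2 (resp. its inverse) are then linear in the
    diagonal entries of x2 (resp. of its adjugate) with a Vandermonde matrix, and
    what is left is to choose off-diagonal entries with given products
    x_jk x_kj and given determinant, a quadratic problem. *)

(** * Explicit 3x3 matrices and the commutator trace identity *)

Section Matrix3.
Variable K : comNzRingType.
Implicit Types A B M : 'M[K]_3.

Definition mx3 (a b c d e f g h i : K) : 'M_3 :=
  \matrix_(k, l) nth 0 (nth [::] [:: [:: a; b; c]; [:: d; e; f]; [:: g; h; i]] k) l.

Lemma mx3_eta M : exists a b c d e f g h i, M = mx3 a b c d e f g h i.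
Proof.
exists (M 0 0), (M 0 1), (M 0 2%:R), (M 1 0), (M 1 1), (M 1 2%:R),
  (M 2%:R 0), (M 2%:R 1), (M 2%:R 2%:R).
apply/matrixP => -[[|[|[|//]]] hk] [[|[|[|//]]] hl]; rewrite mxE /=;
  by congr (M _ _); apply/val_inj.
Qed.

Lemma mulmx3 a b c d e f g h i a' b' c' d' e' f' g' h' i' :
  mx3 a b c d e f g h i *m mx3 a' b' c' d' e' f' g' h' i' =
  mx3 (a * a' + b * d' + c * g') (a * b' + b * e' + c * h')
      (a * c' + b * f' + c * i')
      (d * a' + e * d' + f * g') (d * b' + e * e' + f * h')
      (d * c' + e * f' + f * i')
      (g * a' + h * d' + i * g') (g * b' + h * e' + i * h')
      (g * c' + h * f' + i * i').
Proof.
apply/matrixP => -[[|[|[|//]]] hk] [[|[|[|//]]] hl];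
  by rewrite !mxE !big_ord_recl big_ord0 !mxE /= addr0 addrA.
Qed.

Lemma mxtrace3 a b c d e f g h i : \tr (mx3 a b c d e f g h i) = a + e + i.
Proof. by rewrite /mxtrace !big_ord_recl big_ord0 !mxE /= addr0 addrA. Qed.

Lemma det3 a b c d e f g h i : \det (mx3 a b c d e f g h i) =
  a * (e * i - f * h) - b * (d * i - f * g) + c * (d * h - e * g).
Proof.
rewrite (expand_det_row _ 0) !big_ord_recl big_ord0 /cofactor.
rewrite !(expand_det_row _ 0) !big_ord_recl !big_ord0 /cofactor !det_mx11 !mxE /=.
rewrite /bump /=; ring.
Qed.

Lemma adjmx3 a b c d e f g h i : \adj (mx3 a b c d e f g h i) =
  mx3 (e * i - f * h) (c * h - b * i) (b * f - c * e)
      (f * g - d * i) (a * i - c * g) (c * d - a * f)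
      (d * h - e * g) (b * g - a * h) (a * e - b * d).
Proof.
apply/matrixP => -[[|[|[|//]]] hk] [[|[|[|//]]] hl];
  rewrite !mxE /cofactor !(expand_det_row _ 0) !big_ord_recl !big_ord0;
  rewrite /cofactor !det_mx11 !mxE /= /bump /=; ring.
Qed.

Definition mx3E := (mulmx3, mxtrace3, det3, adjmx3).

(** Powers of [\det A] and [\det B] make every term of degree 3 in each matrix, so that the identity
    is a formal one in the 18 entries, free of any determinant condition. *)
Lemma tr_commutatorD_homog A B :
  \tr (A *m B *m (\adj A *m \adj B)) + \tr (B *m A *m (\adj B *m \adj A)) =
  \tr A * \tr (\adj A) * \tr B * \tr (\adj B)
  - \tr A * \tr B * \tr (\adj A *m \adj B)
  - \tr (\adj A) * \tr (\adj B) * \tr (A *m B)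
  - \tr A * \tr (\adj B) * \tr (\adj A *m B)
  - \tr (\adj A) * \tr B * \tr (A *m \adj B)
  + \tr A * \tr (\adj A) * \det B + \tr B * \tr (\adj B) * \det A
  + \tr (A *m B) * \tr (\adj A *m \adj B)
  + \tr (A *m \adj B) * \tr (\adj A *m B) - 3%:R * \det A * \det B.
Proof.
have [a [b [c [d [e [f [g [h [i ->]]]]]]]]] := mx3_eta A.
have [a' [b' [c' [d' [e' [f' [g' [h' [i' ->]]]]]]]]] := mx3_eta B.
rewrite !mx3E; ring.
Qed.

Lemma tr_commutatorD A B : \det A = 1 -> \det B = 1 ->
  \tr (A *m B *m (\adj A *m \adj B)) + \tr (B *m A *m (\adj B *m \adj A)) =
  \tr A * \tr (\adj A) * \tr B * \tr (\adj B)
  - \tr A * \tr B * \tr (\adj A *m \adj B)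
  - \tr (\adj A) * \tr (\adj B) * \tr (A *m B)
  - \tr A * \tr (\adj B) * \tr (\adj A *m B)
  - \tr (\adj A) * \tr B * \tr (A *m \adj B)
  + \tr A * \tr (\adj A) + \tr B * \tr (\adj B)
  + \tr (A *m B) * \tr (\adj A *m \adj B)
  + \tr (A *m \adj B) * \tr (\adj A *m B) - 3%:R.
Proof. by move=> dA dB; rewrite tr_commutatorD_homog dA dB !mulr1. Qed.

End Matrix3.

Arguments mx3 {K}.

(** * Pairs of unimodular matrices with prescribed traces *)

Section Prescribed.
Variable K : closedFieldType.

Lemma split_quadratic (s p : K) : exists x y, x + y = s /\ x * y = p.
Proof.
have [x xE] := @solve_monicpoly K 2 (fun i => nth 0 [:: - p; s] i) isT.
exists x, (s - x); split; first by ring.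
move: xE; rewrite !big_ord_recl big_ord0 /= /bump /= expr1 expr0 => xE.
have -> : x * (s - x) = s * x - x ^+ 2 by ring.
rewrite xE; ring.
Qed.

Lemma split_cubic (s t p : K) : exists a b c : K,
  [/\ a + b + c = s, a * b + a * c + b * c = t & a * b * c = p].
Proof.
have [a aE] := @solve_monicpoly K 3 (fun i => nth 0 [:: p; - t; s] i) isT.
move: aE; rewrite !big_ord_recl big_ord0 /= /bump /= expr1 expr0 => aE.
have [b [c [bcD bcM]]] := split_quadratic (s - a) (t - a * (s - a)).
exists a, b, c; split.
- by rewrite -addrA bcD; ring.
- by rewrite -mulrDr bcD bcM; ring.
- rewrite -mulrA bcM.
  have -> : a * (t - a * (s - a)) = a ^+ 3 - s * a ^+ 2 + t * a by ring.
  rewrite aE; ring.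
Qed.

(** Each [ui], [vi] will be a pair of opposite off-diagonal entries. If [x] or [y] is nonzero, two
    entries of its triple can be set to 1; if both vanish, some [pi] is 0 and both entries of that
    pair are set to 0. *)
Lemma split_triple {p1 p2 p3 x y : K} : x * y = p1 * p2 * p3 ->
  exists u1 v1 u2 v2 u3 v3, [/\ u1 * v1 = p1, u2 * v2 = p2, u3 * v3 = p3,
    u1 * u2 * u3 = x & v1 * v2 * v3 = y].
Proof.
have [-> | x0] := eqVneq x 0; last first.
  exists 1, p1, 1, p2, x, (p3 / x); split; try by field.
  by rewrite mulrA -H mulrAC divff ?mul1r.
have [-> | y0] := eqVneq y 0; last first.
  move=> H; exists p1, 1, p2, 1, (p3 / y), y; split; try by field.
  by rewrite mulrA -H !mul0r.
rewrite mul0r => /esym/eqP; rewrite !mulf_eq0 -orbA => /or3P[] /eqP ->.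
- by exists 0, 0, 1, p2, 1, p3; split; ring.
- by exists 1, p1, 0, 0, 1, p3; split; ring.
- by exists 1, p1, 1, p2, 0, 0; split; ring.
Qed.

(** As [a2 * a3] is the inverse of [a1], the system has the powers 0, 1, -1 of the [ai] as rows.
    Weighting the equations by the coefficients of [(X - a2) * (X - a3) / X] isolates [d1], and
    likewise for the others. *)
Lemma lagrange3 {a1 a2 a3 : K} (u v w : K) :
  a1 != a2 -> a1 != a3 -> a2 != a3 -> a1 * a2 * a3 = 1 ->
  exists d1 d2 d3, [/\ d1 + d2 + d3 = u, a1 * d1 + a2 * d2 + a3 * d3 = v
    & a2 * a3 * d1 + a1 * a3 * d2 + a1 * a2 * d3 = w].
Proof.
rewrite -subr_eq0 -[a1 == a3]subr_eq0 -[a2 == a3]subr_eq0 => n12 n13 n23 e.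
exists (a1 * (v - (a2 + a3) * u + a2 * a3 * w) / ((a1 - a2) * (a1 - a3))).
exists (a2 * (v - (a1 + a3) * u + a1 * a3 * w) / ((a2 - a1) * (a2 - a3))).
exists (a3 * (v - (a1 + a2) * u + a1 * a2 * w) / ((a3 - a1) * (a3 - a2))).
have n21 : a2 - a1 != 0 by rewrite -opprB oppr_eq0.
have n31 : a3 - a1 != 0 by rewrite -opprB oppr_eq0.
have n32 : a3 - a2 != 0 by rewrite -opprB oppr_eq0.
split; [by field; do ?[apply/andP; split] | by field; do ?[apply/andP; split] |].
rewrite -[RHS]mul1r -e; by field; do ?[apply/andP; split].
Qed.

(* Discriminant of X^3 - s X^2 + t X - 1. *)
Definition disc3 {A : comNzRingType} (s t : A) : A :=
  s ^+ 2 * t ^+ 2 - 4%:R * t ^+ 3 - 4%:R * s ^+ 3 - 27%:R + 18%:R * s * t.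

Lemma prescribed_traces (s1 r1 s2 r2 s3 r3 s4 r4 : K) : disc3 s1 r1 != 0 ->
  exists A B : 'M[K]_3, [/\ \det A = 1, \det B = 1,
    [/\ \tr A = s1, \tr (\adj A) = r1, \tr B = s2 & \tr (\adj B) = r2]
    & [/\ \tr (A *m B) = s3, \tr (\adj A *m \adj B) = r3,
      \tr (A *m \adj B) = s4 & \tr (\adj A *m B) = r4]].
Proof.
have [a1 [a2 [a3 [<- <- e3]]]] := split_cubic s1 r1 1.
have -> : disc3 (a1 + a2 + a3) (a1 * a2 + a1 * a3 + a2 * a3) =
    ((a1 - a2) * (a1 - a3) * (a2 - a3)) ^+ 2.
  (* With the constant term restored as [p], the discriminant formula is an identity in [a1], [a2],
     [a3]. *)
  transitivity (let s := a1 + a2 + a3 in let t := a1 * a2 + a1 * a3 + a2 * a3 in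
    let p := a1 * a2 * a3 in s ^+ 2 * t ^+ 2 - 4%:R * t ^+ 3
    - 4%:R * s ^+ 3 * p - 27%:R * p ^+ 2 + 18%:R * s * t * p); last by rewrite /=; ring.
  by rewrite /= e3 /disc3; ring.
rewrite expf_eq0 /= !mulf_eq0 !negb_or !subr_eq0 -andbA => /and3P[n12 n13 n23].
(* The [di] are to be the diagonal of [B], the [ci] that of [\adj B]; then each [pi] is forced as
   the product of two opposite off-diagonal entries of [B]. *)
have [d1 [d2 [d3 [<- <- <-]]]] := lagrange3 s2 s3 r4 n12 n13 n23 e3.
have [c1 [c2 [c3 [<- <- <-]]]] := lagrange3 r2 s4 r3 n12 n13 n23 e3.
pose p1 := d2 * d3 - c1; pose p2 := d1 * d3 - c2; pose p3 := d1 * d2 - c3.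
(* Here [x] and [y] are the terms of [\det B] from the two 3-cycles: their product is
   [p1 * p2 * p3], and determinant 1 fixes their sum. *)
have [x [y [xyD xyM]]] := split_quadratic
  (1 - d1 * d2 * d3 + d1 * p1 + d2 * p2 + d3 * p3) (p1 * p2 * p3).
have [u1 [v1 [u2 [v2 [u3 [v3 [h1 h2 h3 hx hy]]]]]]] := split_triple xyM.
exists (mx3 a1 0 0 0 a2 0 0 0 a3), (mx3 d1 u3 v2 v3 d2 u1 u2 v1 d3).
have C1 : d2 * d3 - u1 * v1 = c1 by rewrite h1 /p1; ring.
have C2 : d1 * d3 - v2 * u2 = c2 by rewrite [v2 * _]mulrC h2 /p2; ring.
have C3 : d1 * d2 - u3 * v3 = c3 by rewrite h3 /p3; ring.
rewrite !mx3E; split.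
- by rewrite -e3; ring.
- transitivity (d1 * d2 * d3 + (u1 * u2 * u3 + v1 * v2 * v3)
    - d1 * (u1 * v1) - d2 * (u2 * v2) - d3 * (u3 * v3)); first by ring.
  by rewrite hx hy xyD h1 h2 h3; ring.
- by rewrite C1 C2 C3; split; ring.
- by rewrite C1 C2 C3; split; ring.
Qed.
End Prescribed.

(** * Polynomials vanishing at every point *)

Lemma poly_eq0_of_roots (K : numDomainType) (p : {poly K}) :
  (forall x, p.[x] = 0) -> p = 0.
Proof.
move=> p0; apply/eqP/negPn/negP => /max_poly_roots.
(* In characteristic 0 these are [size p] distinct roots, one more than the degree allows. *)
move/(_ [seq k%:R | k <- iota 0 (size p)]).
rewrite size_map size_iota ltnn => bound; suff: false by []; apply: bound.
- by apply/allP => x _; apply/eqP.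
- by rewrite map_inj_uniq ?iota_uniq // => k l /eqP; rewrite eqr_nat => /eqP.
Qed.

Lemma poly_size_le2 (A : nzRingType) (r : {poly A}) :
  (size r <= 2)%N -> r = (r`_1)%:P * 'X + (r`_0)%:P.
Proof.
move=> sr; apply/polyP => -[|[|k]]; rewrite coefD coefMX !coefC /= ?add0r ?addr0 //.
by rewrite nth_default // (leq_trans sr).
Qed.

Section Muni.
Variables (K : comNzRingType) (n : nat).
Implicit Types (p : {mpoly K[n.+1]}) (v : 'I_n.+1 -> K).

Lemma meval_muni p v : p.@[v] =
  (map_poly (meval (fun i : 'I_n => v (widen_ord (leqnSn n) i))) (muni p)).[v ord_max].
Proof.
rewrite muniE mevalE raddf_sum horner_sum; apply: eq_bigr => m _ /=.
rewrite -mul_mpolyC -mul_polyC rmorphM /= map_polyC /= map_polyXn.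
rewrite hornerM hornerC hornerXn mevalM mevalC mevalX big_ord_recr /= -mulrA.
by congr (_ * (_ * _)); apply: eq_bigr => i _; rewrite mnmE.
Qed.

(** A left inverse widens the coefficients and substitutes the last variable. *)
Lemma muni_inj : injective (@muni n K).
Proof.
apply: can_inj (fun q => (map_poly (@mwiden n K) q).['X_ord_max]) _ => p.
rewrite muniE raddf_sum horner_sum [RHS]mpolyE; apply: eq_bigr => m _ /=.
rewrite -mul_polyC rmorphM /= map_polyC /= map_polyXn hornerM hornerC hornerXn.
rewrite mwidenZ mwidenX -scalerAl mpolyXn -mpolyXD; congr (_ *: 'X_[_]).
apply/mnmP => i; rewrite mnmDE mulmnE mnm1E.
case: (unliftP ord_max i) => [j|] ->.
  have -> : lift ord_max j = widen_ord (leqnSn n) j.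
    by apply/val_inj; rewrite /= /bump leqNgt ltn_ord.
  rewrite mnmwiden_widen mnmE (_ : (_ == _) = false) ?mul0n ?addn0 //.
  by apply/negP => /eqP/(congr1 val)/= E; have := ltn_ord j; rewrite -E ltnn.
by rewrite mnmwiden_ordmax eqxx mul1n.
Qed.

End Muni.

Lemma mpoly_eq0_of_meval (K : numDomainType) n (p : {mpoly K[n]}) :
  (forall v, p.@[v] = 0) -> p = 0.
Proof.
elim: n p => [|n IHn] p p0.
  have := p0 (fun=> 0); rewrite (nvar0_mpolyC p) mevalC => ->.
  by rewrite mpolyC0.
apply: muni_inj; rewrite muni0; apply/polyP => k; rewrite coef0.
apply: IHn => v; transitivity ((map_poly (meval v) (muni p))`_k).
  by rewrite coef_map.
rewrite (_ : map_poly _ _ = 0) ?coef0 //; apply: poly_eq0_of_roots => x.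
(* The point [v] extended by [x] in the last coordinate. *)
pose w (i : 'I_n.+1) := oapp v x (unlift ord_max i).
rewrite -(p0 w) meval_muni {2}/w unlift_none /=; congr (_.[_]).
apply: eq_map_poly => q; apply: meval_eq => i; rewrite /w.
have -> : widen_ord (leqnSn n) i = lift ord_max i.
  by apply/val_inj; rewrite /= /bump leqNgt ltn_ord.
by rewrite liftK.
Qed.

Lemma invmx_det1 (K : comUnitRingType) n (A : 'M[K]_n) :
  \det A = 1 -> invmx A = \adj A.
Proof. by move=> dA; rewrite /invmx unitmxE dA unitr1 invr1 scale1r. Qed.

Lemma rmorph_disc3 (A B : comNzRingType) (h : {rmorphism A -> B}) s t :
  h (disc3 s t) = disc3 (h s) (h t).
Proof.
by rewrite /disc3 rmorphD 3!rmorphB !(rmorphXn, rmorph_nat, rmorphM).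
Qed.

(** * Pointwise evaluation, injectivity on R, and transposition *)

Section Evaluation.
Variable R : realType.
Implicit Types (x : SL3 R * SL3 R) (f : {mpoly R[i][8]}).

Definition inv_eval x (f : invariant_ring R) : R[i] := f x.

Fact inv_eval_is_zmod x : zmod_morphism (inv_eval x).
Proof. by []. Qed.
Fact inv_eval_is_monoid x : monoid_morphism (inv_eval x).
Proof. by []. Qed.
HB.instance Definition _ x :=
  GRing.isZmodMorphism.Build _ _ (inv_eval x) (inv_eval_is_zmod x).
HB.instance Definition _ x :=
  GRing.isMonoidMorphism.Build _ _ (inv_eval x) (inv_eval_is_monoid x).

Definition traces x (i : 'I_8) : R[i] := tr R (Pi_word i) x.

Lemma Pi_RtE f x : Pi_Rt R f x = f.@[traces x].
Proof.
rewrite -[LHS]/(inv_eval x (mmap (@inv_cst R) (fun i => tr R (Pi_word i)) f)).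
rewrite /mmap rmorph_sum mevalE; apply: eq_bigr => m _.
by rewrite rmorphM rmorph_prod; congr (_ * _); apply: eq_bigr => i _; rewrite rmorphXn.
Qed.

Lemma Pi_polyC (F : {poly {mpoly R[i][8]}}) : Pi R F%:P = Pi_Rt5 R F.
Proof. by rewrite /= map_polyC /= /horner_eval hornerC. Qed.

Lemma ideal_IE (F : {poly {mpoly R[i][8]}}) : ideal_I R F <-> Pi_Rt5 R F = 0.
Proof.
rewrite -Pi_polyC -[F%:P]subr0.
have -> : ideal_I R F = (quot_Pi R F = \pi_{ideal_quot ker_Pi R}%qT 0).
  by rewrite rmorph0.
split=> [/eqP | F0].
  by rewrite -Quotient.idealrBE => /eqP.
by apply/eqP; rewrite -Quotient.idealrBE; apply/eqP.
Qed.

Lemma Pi_Rt5C f : Pi_Rt5 R f%:P = Pi_Rt R f.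
Proof. by rewrite /= map_polyC /= /horner_eval hornerC. Qed.

Definition T5 := tr R (Mul (Mul X1 X2) (Mul (Inv X1) (Inv X2))).
Definition Tm5 := tr R (Mul (Mul X2 X1) (Mul (Inv X2) (Inv X1))).

Lemma Pi_Rt5X : Pi_Rt5 R 'X = T5.
Proof. by rewrite /= map_polyX /horner_eval hornerX. Qed.

Lemma Pi_X : Pi R 'X = Tm5.
Proof. by rewrite /= map_polyX /horner_eval hornerX. Qed.

Lemma tracesE x k : (k < 8)%N -> traces x (inord k) =
  tr R (nth X1 [:: X1; Inv X1; X2; Inv X2; Mul X1 X2; Mul (Inv X1) (Inv X2);
    Mul X1 (Inv X2); Mul (Inv X1) X2] k) x.
Proof. by move=> k8; rewrite /traces /Pi_word (tnth_nth X1) inordK. Qed.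

Lemma invariant_ext (f h : invariant_ring R) : (forall x, f x = h x) -> f = h.
Proof. by move=> fh; apply/val_inj/boolp.funext. Qed.

Lemma Pi_Rt_trace_P : Pi_Rt R (trace_P R) = T5 + Tm5.
Proof.
apply: invariant_ext => -[g h]; rewrite Pi_RtE /trace_P.
rewrite !(rmorph_nat, rmorphB, rmorphD, rmorphM) /= !mevalXU !tracesE //=.
rewrite -[RHS]/(T5 (g, h) + Tm5 (g, h)) /= !invmx_det1 ?detSL3 //.
by rewrite (tr_commutatorD _ g h) ?detSL3.
Qed.

Lemma Pi_Rt_inj f : Pi_Rt R f = 0 -> f = 0.
Proof.
(* The factor [disc3] covers the points of 8-space where [prescribed_traces] does not apply. *)
move=> f0; have /eqP: f * disc3 (t1 R) (tm1 R) = 0.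
  apply: mpoly_eq0_of_meval => v; rewrite mevalM.
  rewrite rmorph_disc3 /= !mevalXU.
  have [-> | d0] := eqVneq (disc3 (v (inord 0)) (v (inord 1))) 0; first exact: mulr0.
  have [A [B [/eqP dA /eqP dB [h0 h1 h2 h3] [h4 h5 h6 h7]]]] :=
    prescribed_traces _ _ _ (v (inord 2)) (v (inord 3)) (v (inord 4)) (v (inord 5))
      (v (inord 6)) (v (inord 7)) d0.
  pose x := (MkSL3 dA, MkSL3 dB).
  rewrite -(@meval_eq _ _ (traces x)) -?Pi_RtE ?f0 ?mul0r // => i.
  rewrite -(inord_val i); case: i => -[|[|[|[|[|[|[|[|//]]]]]]]] hi /=;
    by rewrite tracesE //= ?invmx_det1 //; apply/eqP.
(* At the origin [disc3] takes the value -27, so it is not the zero polynomial. *)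
rewrite mulf_eq0 => /orP[/eqP //|/eqP/(congr1 (meval (fun=> 0)))/eqP].
rewrite rmorph_disc3 /= !mevalXU mevalC /disc3.
by rewrite !(expr0n, mul0r, mulr0, oppr0, addr0, add0r) oppr_eq0 pnatr_eq0.
Qed.

Definition SL3_tr (g : SL3 R) : SL3 R :=
  MkSL3 (introT eqP (etrans (det_tr g) (detSL3 g))).

Definition SL3_tr2 x := (SL3_tr x.1, SL3_tr x.2).

Lemma traces_tr x : traces (SL3_tr2 x) =1 traces x.
Proof.
move=> i; rewrite -(inord_val i); case: i => -[|[|[|[|[|[|[|[|//]]]]]]]] hi /=;
  by rewrite !tracesE //= -?trmx_inv -?trmx_mul ?mxtrace_tr // mxtrace_mulC.
Qed.

(** Transposition reverses the commutator word, and a cyclic shift of the result is the word of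
    [Tm5]. *)
Lemma T5_tr x : T5 (SL3_tr2 x) = Tm5 x.
Proof.
by rewrite /= -!trmx_inv -!trmx_mul mxtrace_tr mxtrace_mulC.
Qed.

Lemma T5E x : T5 x = \tr (x.1 *m x.2 *m (\adj x.1 *m \adj x.2)).
Proof. by rewrite /= !invmx_det1 ?detSL3. Qed.

Lemma Tm5E x : Tm5 x = \tr (x.2 *m x.1 *m (\adj x.2 *m \adj x.1)).
Proof. by rewrite /= !invmx_det1 ?detSL3. Qed.

Lemma T5_neq_Tm5 : exists x, T5 x != Tm5 x.
Proof.
pose A : 'M[R[i]]_3 := mx3 0 1 1 0 0 1 1 0 0.
pose B : 'M[R[i]]_3 := mx3 0 1 0 0 0 1 1 1 0.
have dA : \det A == 1 by rewrite det3; apply/eqP; ring.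
have dB : \det B == 1 by rewrite det3; apply/eqP; ring.
exists (MkSL3 dA, MkSL3 dB); rewrite T5E Tm5E.
rewrite /A /B !mx3E.
rewrite [X in X != _](_ : _ = 1%:R); last by ring.
rewrite [X in _ != X](_ : _ = 3%:R); last by ring.
by rewrite eqr_nat.
Qed.

End Evaluation.

(** * The quadratic relation and division by it *)

Lemma Pi_Rt_Q (R : realType) (Q : {mpoly R[i][8]})
    (hQ : Q%:P%:P - t5 R * tm5 R \in ker_Pi R) :
  Pi_Rt R Q = T5 R * Tm5 R.
Proof.
have : Pi R (Q%:P%:P - t5 R * tm5 R) == 0 := hQ.
by rewrite rmorphB rmorphM !Pi_polyC Pi_Rt5C Pi_Rt5X Pi_X subr_eq0 => /eqP.
Qed.

Lemma disc_neq0 (R : realType) (Q : {mpoly R[i][8]})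
    (hQ : Q%:P%:P - t5 R * tm5 R \in ker_Pi R) :
  trace_P R ^+ 2 - 4%:R * Q != 0.
Proof.
apply/negP => /eqP/(congr1 (Pi_Rt R)).
rewrite rmorphB rmorphXn rmorphM rmorph_nat Pi_Rt_trace_P (Pi_Rt_Q _ _ hQ) rmorph0.
have -> : (T5 R + Tm5 R) ^+ 2 - 4%:R * (T5 R * Tm5 R) = (T5 R - Tm5 R) ^+ 2 by ring.
have [x /negP neq] := T5_neq_Tm5 R.
move=> /(congr1 (inv_eval R x))/eqP; rewrite rmorphXn rmorphB rmorph0 /=.
by rewrite expf_eq0 subr_eq0.
Qed.

Lemma T5_free (R : realType) (Q : {mpoly R[i][8]})
    (hQ : Q%:P%:P - t5 R * tm5 R \in ker_Pi R)
    (a b : {mpoly R[i][8]}) :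
  Pi_Rt R a * T5 R + Pi_Rt R b = 0 -> a = 0 /\ b = 0.
Proof.
move=> ab0; suff a0 : a = 0.
  by split=> //; apply: Pi_Rt_inj; move: ab0; rewrite a0 rmorph0 mul0r add0r.
have aT : Pi_Rt R a * (T5 R - Tm5 R) = 0.
  apply: invariant_ext => x.
  have abE y : a.@[traces R y] * T5 R y + b.@[traces R y] = 0.
    by rewrite -!Pi_RtE -[LHS]/(inv_eval R y (Pi_Rt R a * T5 R + Pi_Rt R b)) ab0.
  rewrite -[LHS]/(Pi_Rt R a x * (T5 R x - Tm5 R x)) Pi_RtE.
  (* The relation at the transposed pair has the same coefficients, with [Tm5] for [T5]; the
     difference of the two is the claim. *)
  have := abE (SL3_tr2 R x); rewrite T5_tr !(meval_eq _ (traces_tr R x)).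
  by move=> E; rewrite mulrBr -[RHS](subrr 0) -{1}(abE x) -E; ring.
suff /eqP : a * (trace_P R ^+ 2 - 4%:R * Q) = 0.
  by rewrite mulf_eq0 (negPf (disc_neq0 _ _ hQ)) orbF => /eqP.
apply: Pi_Rt_inj.
rewrite rmorphM rmorphB rmorphXn rmorphM rmorph_nat Pi_Rt_trace_P (Pi_Rt_Q _ _ hQ).
by transitivity (Pi_Rt R a * (T5 R - Tm5 R) * (T5 R - Tm5 R));
  [ring | rewrite aT mul0r].
Qed.

Theorem lemma7 (R : realType) (Q : {mpoly R[i][8]})
    (hQ : Q%:P%:P - t5 R * tm5 R \in ker_Pi R) :
  ideal_I R = principal_ideal ('X^2 - (trace_P R)%:P * 'X + Q%:P).
Proof.
set D := 'X^2 - _ + _.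
(* Monicity permits exact division although the coefficients do not form a field. *)
have D3 : size D = 3%N /\ D \is monic.
  have E : D = 'X^2 + (Q%:P - (trace_P R)%:P * 'X) by rewrite /D; ring.
  have lt3 : (size (Q%:P - (trace_P R)%:P * 'X)%R < size ('X^2 : {poly {mpoly R[i][8]}})%R)%N.
    rewrite size_polyXn ltnS (leq_trans (size_polyD _ _)) // geq_max size_polyN.
    rewrite (leq_trans (size_polyC_leq1 _)) //= mul_polyC.
    by rewrite (leq_trans (size_scale_leq _ _)) ?size_polyX.
  by rewrite monicE E lead_coefDl // size_polyDl // size_polyXn lead_coefXn.
(* [D] maps to [(T5 - T5) * (T5 - Tm5)], by the sum and product of the two commutator traces. *)
have D0 : Pi_Rt5 R D = 0.
  rewrite /D rmorphD rmorphB rmorphXn rmorphM !Pi_Rt5C Pi_Rt5X Pi_Rt_trace_P.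
  by rewrite (Pi_Rt_Q _ _ hQ); ring.
apply/seteqP; split=> F; last first.
  by case=> b _ <-; apply/ideal_IE; rewrite rmorphM D0 mulr0.
move=> /ideal_IE F0; case: D3 => D3 Dm.
exists (rdivp F D) => //; rewrite [RHS](rdivp_eq Dm F).
rewrite -[LHS]addr0; congr (_ + _); apply/esym.
have: (size (rmodp F D) <= 2)%N.
  by have := ltn_rmodpN0 F (monic_neq0 Dm); rewrite [X in (_ < X)%N]D3.
have: Pi_Rt5 R (rmodp F D) = 0.
  by move: F0; rewrite {1}(rdivp_eq Dm F) rmorphD rmorphM D0 mulr0 add0r.
move: (rmodp F D) => r r0 sr.
move: r0; rewrite (poly_size_le2 _ _ sr) rmorphD rmorphM !Pi_Rt5C Pi_Rt5X.
move=> /(T5_free _ _ hQ _ _)[-> ->].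
by rewrite mul0r addr0.
Qed.
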